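(* Let $y,z,k$ be positive integers with $k>16$ and $k>yz$. Suppose that - $\Sigma:=\dfrac{8(z^2+k)}{k-16}$ is an integer, - $\Sigma':=\dfrac{y^2\,\Sigma}{k}$ is an integer, - $x:=\sqrt{\dfrac{k(\Sigma+\Sigma')}{8}}$ is an integer. Then one of the following holds: (a) $(\Sigma,\Sigma')=(9,9),(12,24),(16,16),(24,12),(10,40),(40,10)$ or $(18,32)$; (b) $(\Sigma,\Sigma')=(5m^2,5)$ for some integer $m$ for which there exist integers $n,Y,Z$ such that $m^2-10n^2=-1$ and $(5m^2-8)Y^2=5+8Z^2$; (c) $(\Sigma,\Sigma')=(m^2,1)$ for some integer $m$ for which there exist integers $n,Y,Z$ such that $m^2-2n^2=-1$ and $(m^2-8)Y^2=1+8Z^2$. *)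

(* Defs.v *)
From mathcomp Require Export all_boot all_order all_algebra.
From mathcomp Require Export reals.

(* Main.v *)
Require Import Defs.
From Stdlib Require Import ZArith.
From mathcomp Require Import all_boot all_order all_algebra.
From mathcomp Require Import reals.
From mathcomp Require Import finfield.
From mathcomp Require Import zify ring.
Import Order.TTheory GRing.Theory Num.Theory.
Local Open Scope ring_scope.
Local Delimit Scope Z_scope with BZ.

(** Write s = Sigma, s' = Sigma', t = s - 8, t' = s' - 8 and h = k - 16.  The
hypotheses become t h = 8 (z^2 + 16), s' k = y^2 s and 8 x^2 = k (s + s'), and
they force 2 s s' (s + s') to be a square.

If s' > 8, the condition y z < k amounts to h (t t' - 64) < 128 (t + t' + 16).
For h < 200 only finitely many (k, z, y) satisfy y z < k; for h >= 200 the
inequality bounds t and t', and the square condition leaves the list of (a)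
together with (9, 72) and (72, 9), which are impossible modulo powers of 2.

If s' <= 8, the square condition with s' = p odd gives s = p d1 a^2 and
s + p = p d2 b^2 with d1 d2 = 2 p, a Pell-type equation between a and b.  All
cases but (p, d1) = (1, 1), (5, 1) are excluded by congruences, by a 2-, 3- or
7-adic descent, or because no divisor of z^2 + 16 is congruent to 3 modulo 4;
s' = 4 and s' = 6 reduce to the same kind of equations, while for
s' = 2 and s' = 8 the square lies too close to (2 s)^2 and (4 s)^2. *)

(** * Divisors of z^2 + 16 *)

(** Otherwise z^2 = -4^2 in F_p. Write p = 4 h + 3; as (p - 1) / 2 = 2 h + 1 is odd, Fermat's
    theorem for z and for 4 gives 4 z = -4 z, so p divides a power of 2. *)
Lemma prime3mod4_ndvd (p z : nat) :
  prime p -> (p %% 4 = 3)%N -> ~~ (p %| z ^ 2 + 16)%N.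
Proof.
move=> pp p3; apply/negP => pz.
have natF0 n : (n%:R == 0 :> 'F_p) = (p %| n)%N.
  by rewrite (dvdn_pcharf (pchar_Fp pp)).
have fermat (x : 'F_p) n : n = p -> x ^+ n = x.
  by move->; rewrite -[in RHS](expf_card x) card_Fp.
have [h hE] : exists h, p = (4 * h).+3 by exists (p %/ 4)%N; lia.
have twoX n : ~~ (p %| 2 ^ n)%N.
  apply/negP; rewrite Euclid_dvdX // => /andP[+ _].
  by move/dvdn_leq; lia.
set x : 'F_p := z%:R.
have x2 : x ^+ 2 = - 4%:R ^+ 2.
  apply/eqP; rewrite -subr_eq0 opprK -!natrX -natrD natF0; exact: pz.
have xp : x = - x * 4%:R ^+ (2 * (2 * h + 1)).
  rewrite -{1}(fermat x (1 + 2 * (2 * h + 1))%N); last lia.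
  rewrite exprD expr1 exprM x2 exprNn exprD mulnC; rewrite -!exprM.
  by rewrite [in (-1) ^+ _]exprM sqrr_sign; ring.
(* The factor 4 allows Fermat's theorem in the form 4^p = 4, without inverses. *)
have : x * 8%:R = 0.
  have f4 : 4%:R * 4%:R ^+ (2 * (2 * h + 1)) = 4%:R :> 'F_p.
    rewrite -exprS fermat //; lia.
  have : x * 4%:R = - x * 4%:R.
    by rewrite {1}xp -mulrA [_ ^+ _ * _]mulrC f4.
  by move=> e; rewrite -[8%:R]/((4 + 4)%:R) natrD mulrDr {2}e; ring.
move/eqP; rewrite mulf_eq0 => /orP[x0|].
  move: x2; rewrite (eqP x0) expr0n /= => /esym/eqP.
  by rewrite oppr_eq0 -natrX natF0 -[(4 ^ 2)%N]/(2 ^ 4)%N (negPf (twoX _)).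
by rewrite natF0 -[8%N]/(2 ^ 3)%N (negPf (twoX _)).
Qed.

(** If the least prime factor is not 3 modulo 4 it is 1 modulo 4, so the cofactor is again 3 modulo
    4 and induction applies. *)
Lemma prime3mod4_exists (m : nat) :
  (m %% 4 = 3)%N -> exists p, [/\ prime p, (p %| m)%N & (p %% 4 = 3)%N].
Proof.
elim/ltn_ind: m => m IH m3.
have m1 : (1 < m)%N by lia.
have pp := pdiv_prime m1; have /dvdnP[q mE] := pdiv_dvd m.
have p2 := prime_gt1 pp.
have [p3|p3] := eqVneq (pdiv m %% 4)%N 3%N; first by exists (pdiv m); rewrite pdiv_dvd.
have p1 : (pdiv m %% 4 = 1)%N.
  have : (m %% 4 = ((q %% 4) * (pdiv m %% 4)) %% 4)%N by rewrite modnMml modnMmr -mE.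
  move: p3 (ltn_pmod (pdiv m) (isT : (0 < 4)%N)) (ltn_pmod q (isT : (0 < 4)%N)).
  by case: (_ %% 4)%N => [|[|[|[|?]]]]; case: (_ %% 4)%N => [|[|[|[|?]]]]; lia.
have q3 : (q %% 4 = 3)%N.
  have : (m %% 4 = ((q %% 4) * (pdiv m %% 4)) %% 4)%N by rewrite modnMml modnMmr -mE.
  by rewrite p1 muln1 modn_mod => <-.
have [|//|p [pp' pq p3']] := IH q; first nia.
by exists p; split=> //; rewrite mE dvdn_mulr.
Qed.

(** A prime factor of m that is 3 modulo 4 divides neither 8 nor z^2 + 16. It is applied with m a
    divisor of s - 8. *)
Lemma dvd_3mod4 (m t z : int) :
  0 < m -> (m %% 4)%Z = 3 -> m * t <> 8 * (z ^+ 2 + 16).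
Proof.
move=> m0 m3 E.
have [|p [pp pm p3]] := @prime3mod4_exists `|m|%N; first lia.
have : (p %| 2 ^ 3 * (`|z| ^ 2 + 16))%N.
  have -> : (2 ^ 3 * (`|z| ^ 2 + 16) = `|m| * `|t|)%N.
    by have := congr1 absz E; rewrite !abszM; lia.
  exact: dvdn_mulr.
rewrite Euclid_dvdM // (negPf (prime3mod4_ndvd _ _ pp p3)) orbF.
by rewrite Euclid_dvdX // => /andP[/dvdn_leq]; lia.
Qed.

Lemma even_or_odd (a : int) : exists b, a = 2 * b \/ a = 2 * b + 1.
Proof. by exists (a %/ 2)%Z; lia. Qed.

(** Necessarily z = 4 v, and then 4 would divide v^2 + 1. *)
Lemma ndvd64 (z t : int) : z ^+ 2 + 16 <> 64 * t.
Proof.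
have [w [->|->]] := even_or_odd z; last lia.
have [v [->|->]] := even_or_odd w; last lia.
have [u [->|->]] := even_or_odd v; lia.
Qed.

(** * Coprime factors of a square, and the descent to Pell-type equations *)

(** With a = gcd(u, w): a^2 = gcd(u^2, u w, u v) = u gcd(u, w, v) = u. *)
Lemma coprime_mul_square (u v w : nat) :
  coprime u v -> (u * v = w ^ 2)%N -> exists a, u = (a ^ 2)%N.
Proof.
move=> cuv e; exists (gcdn u w).
have cop : gcdn (gcdn u w) (gcdn w v) = 1%N.
  apply/eqP; rewrite -dvdn1 -(eqP cuv) dvdn_gcd.
  rewrite (dvdn_trans (dvdn_gcdl _ _)) ?dvdn_gcdl //.
  by rewrite (dvdn_trans (dvdn_gcdr _ _)) ?dvdn_gcdr.
rewrite -mulnn muln_gcdl !muln_gcdr [(w * w)%N]mulnn -e [(w * u)%N]mulnC.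
by rewrite -!muln_gcdr cop muln1.
Qed.

(** Take d1 = gcd(d, u) and d2 = gcd(d, v). Since d divides u v and u, v are coprime, d1 d2 = d; the
    cofactors of d1 in u and of d2 in v are coprime with square product. *)
Lemma coprime_mul_square_mul (d u v w : nat) :
  (0 < d)%N -> coprime u v -> (d %| w)%N -> (d * (u * v) = w ^ 2)%N ->
  exists d1 d2 a b, [/\ (d1 * d2 = d)%N, u = (d1 * a ^ 2)%N & v = (d2 * b ^ 2)%N].
Proof.
move=> d0 cuv /dvdnP[t ->] e.
have {}e : (u * v = d * t ^ 2)%N.
  by apply/eqP; rewrite -(eqn_pmul2l d0) e; apply/eqP; ring.
have dE : (gcdn d u * gcdn d v = d)%N.
  apply/eqP; rewrite eqn_dvd; apply/andP; split.
    rewrite Gauss_dvd ?dvdn_gcdl //.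
    by rewrite (coprime_dvdl (dvdn_gcdr _ _)) ?(coprime_dvdr (dvdn_gcdr _ _)).
  by rewrite muln_gcdl !muln_gcdr e [(u * d)%N]mulnC !dvdn_gcd !dvdn_mulr.
have d1 : (0 < gcdn d u)%N by rewrite gcdn_gt0 d0.
have d2 : (0 < gcdn d v)%N by rewrite gcdn_gt0 d0.
have /dvdnP[u' uE] := dvdn_gcdr d u; have /dvdnP[v' vE] := dvdn_gcdr d v.
have e' : (u' * v' = t ^ 2)%N.
  apply/eqP; rewrite -(eqn_pmul2l d0) -e {1}uE {1}vE -{1}dE; apply/eqP; ring.
have cuv' : coprime u' v'.
  apply: (@coprime_dvdl _ u); first by rewrite uE dvdn_mulr.
  by apply: (@coprime_dvdr _ v) => //; rewrite vE dvdn_mulr.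
have [a aE] := coprime_mul_square _ _ _ cuv' e'.
have [b bE] : exists b, v' = (b ^ 2)%N.
  by apply: (coprime_mul_square v' u' t); rewrite 1?coprime_sym // mulnC.
exists (gcdn d u), (gcdn d v), a, b; split=> //.
  by rewrite mulnC -aE.
by rewrite mulnC -bE.
Qed.

(** First p divides w, then 2 S^2, hence S = p s. What remains is 2 p s (s + 1) = t^2 with s and s +
    1 coprime and 2 p dividing t. *)
Lemma square_descent (p S w : nat) :
  odd p -> (p == 1%N) || prime p -> (0 < S)%N ->
  (2 * p * S * (S + p) = w ^ 2)%N ->
  exists d1 d2 a b, [/\ (d1 * d2 = 2 * p)%N, S = (p * d1 * a ^ 2)%N
    & (S + p = p * d2 * b ^ 2)%N].
Proof.
move=> op p1 S0 e.
have p0 : (0 < p)%N by case: p op {p1 e}.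
have sqdvd m : (p %| m ^ 2)%N -> (p %| m)%N.
  by case/orP: p1 => [/eqP->|pp]; rewrite ?dvd1n // Euclid_dvdX // => /andP[].
have /dvdnP[t wE] : (p %| w)%N.
  by apply: sqdvd; rewrite -e; apply/dvdnP; exists (2 * S * (S + p))%N; ring.
have {}e : (2 * S * (S + p) = p * t ^ 2)%N.
  by apply/eqP; rewrite -(eqn_pmul2l p0); apply/eqP; move: e; rewrite wE; lia.
have /dvdnP[s SE] : (p %| S)%N.
  apply: sqdvd; rewrite -(@Gauss_dvdr _ 2); last by rewrite coprimen2.
  have : (p %| 2 * S ^ 2 + 2 * S * p)%N by apply/dvdnP; exists (t ^ 2)%N; lia.
  by rewrite (dvdn_addl _ (dvdn_mull _ (dvdnn _))).
have {}e : (2 * p * (s * (s + 1)) = t ^ 2)%N.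
  by apply/eqP; rewrite -(eqn_pmul2l p0) -e SE; apply/eqP; ring.
have d2p : (2 * p %| t)%N.
  rewrite Gauss_dvd ?coprime2n //; apply/andP; split.
    suff : (2 %| t ^ 2)%N by rewrite Euclid_dvdX // => /andP[].
    by rewrite -e -mulnA dvdn_mulr.
  by apply: sqdvd; rewrite -e; apply/dvdnP; exists (2 * (s * (s + 1)))%N; ring.
have p2 : (0 < 2 * p)%N by rewrite muln_gt0.
have csS : coprime s (s + 1) by rewrite addn1 coprimenS.
have [d1 [d2 [a [b [dE sE sE']]]]] := coprime_mul_square_mul _ _ _ _ p2 csS d2p e.
exists d1, d2, a, b; split=> //; first by rewrite SE {1}sE; ring.
by rewrite SE -mulnA -sE'; ring.
Qed.

(** * Squares modulo 8, 3 and 7, and the individual Pell-type cases *)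

Lemma odd_square (a : int) : exists t, (2 * a + 1) ^+ 2 = 8 * t + 1.
Proof.
have [b [->|->]] := even_or_odd a.
  by exists (2 * b ^+ 2 + b); ring.
by exists (2 * b ^+ 2 + 3 * b + 1); ring.
Qed.

Lemma square_mod8 (a : int) :
  exists t, [\/ a ^+ 2 = 8 * t, a ^+ 2 = 8 * t + 1 | a ^+ 2 = 8 * t + 4].
Proof.
have [b [->|->]] := even_or_odd a; last first.
  by have [t ->] := odd_square b; exists t; apply: Or32.
have [c [->|->]] := even_or_odd b.
  by exists (2 * c ^+ 2); apply: Or31; ring.
by exists (2 * c ^+ 2 + 2 * c); apply: Or33; ring.
Qed.

Lemma dvdz_sqr_prime (p : nat) (m : int) :
  prime p -> (p %| m ^+ 2)%Z -> (p %| m)%Z.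
Proof. by move=> pp; rewrite !dvdzE !abszX Euclid_dvdX // => /andP[]. Qed.

Lemma dvdz_sqr (m n : int) : (m ^+ 2 %| n ^+ 2)%Z = (m %| n)%Z.
Proof. by rewrite !dvdzE !abszX dvdn_pexp2r. Qed.

Lemma sqr_absz (a : int) : a ^+ 2 = `|a|%N%:Z ^+ 2.
Proof. by rewrite abszE real_normK ?num_real. Qed.

(* The case s = p d1 a^2, s + p = p d2 b^2 with p = 2 q + 1 and (d1, d2) = (2 p, 1). *)
Lemma no_solution_2p_1 (q a b y z : int) :
  2 * (2 * q + 1) * a ^+ 2 + 1 = b ^+ 2 -> 8 < 2 * (2 * q + 1) ^+ 2 * a ^+ 2 ->
  (2 * (2 * q + 1) ^+ 2 * a ^+ 2 - 8) * (2 * (2 * q + 1) * a ^+ 2 * y ^+ 2 - 16)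
    <> 8 * (z ^+ 2 + 16).
Proof.
move=> eb S8 E.
have [e [aE|aE]] := even_or_odd a; last first.
  by have [c [bE|bE]] := even_or_odd b; rewrite aE bE in eb; lia.
(* Now a = 2 e. For e even the first factor is 8 (4 X - 1), with 4 X - 1 equal to 3 modulo 4; for e
   odd it is 64 t. *)
have [f [eE|eE]] := even_or_odd e.
  set X := (2 * q + 1) ^+ 2 * f ^+ 2.
  have XE : 2 * (2 * q + 1) ^+ 2 * a ^+ 2 = 32 * X by rewrite aE eE /X; ring.
  rewrite XE in S8 E; apply: (dvd_3mod4 (4 * X - 1)
    (8 * (2 * (2 * q + 1) * a ^+ 2 * y ^+ 2 - 16)) z).
  - by clear - S8; lia.
  - by clear; lia.
  - by rewrite -E; ring.
(* The argument is chosen so that its double plus 1 is (2 q + 1) (2 f + 1) = (2 q + 1) e. *)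
have [t tE] := odd_square (2 * q * f + q + f).
apply: (ndvd64 z (t * ((2 * q + 1) * e ^+ 2 * y ^+ 2 - 2))).
have {}tE : (2 * q + 1) ^+ 2 * e ^+ 2 = 8 * t + 1 by rewrite -tE eE; ring.
apply: (@mulfI _ 8) => //; rewrite -E aE.
have -> : 2 * (2 * q + 1) ^+ 2 * (2 * e) ^+ 2 = 8 * (8 * t + 1) by rewrite -tE; ring.
ring.
Qed.

(** The square of 2 c + 1 is 8 t + 1, hence coprime to 8, so it divides z^2. *)
Lemma odd_dvd_of_sq (c z X : int) :
  (2 * c + 1) ^+ 2 * X = 8 * z ^+ 2 -> (2 * c + 1 %| z)%Z.
Proof.
move=> E; have [t tE] := odd_square c.
have : ((2 * c + 1) ^+ 2 %| z ^+ 2)%Z.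
  rewrite -(@Gauss_dvdzr _ 8); first by rewrite -E dvdz_mulr.
  by apply/coprimezP; exists (1, - t) => /=; rewrite tE; ring.
by rewrite dvdz_sqr.
Qed.

(* The case (d1, d2) = (1, 2 p), which yields (b) for p = 5 and (c) for p = 1. *)
Lemma solution_1_2p (q a b y z : int) :
  a ^+ 2 + 1 = 2 * (2 * q + 1) * b ^+ 2 -> 
  ((2 * q + 1) * a ^+ 2 - 8) * (a ^+ 2 * y ^+ 2 - 16) = 8 * (z ^+ 2 + 16) ->
  exists Y Z, ((2 * q + 1) * a ^+ 2 - 8) * Y ^+ 2 = (2 * q + 1) + 8 * Z ^+ 2.
Proof.
move=> eb E.
have [c [aE|aE]] := even_or_odd a; first by rewrite aE in eb; lia.
have [t tE] := odd_square c; rewrite -aE in tE.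
have /dvdzP[Z1 zE] : (a %| z)%Z.
  rewrite aE; apply: (@odd_dvd_of_sq _ _
    ((2 * q + 1) * a ^+ 2 * y ^+ 2 - 16 * (2 * q + 1) - 8 * y ^+ 2)).
  by rewrite -aE; apply: (addIr 128); rewrite -[RHS](mulrDr 8 _ 16) -E; ring.
have a0 : a ^+ 2 != 0 by lia.
have {}E : y ^+ 2 * ((2 * q + 1) * a ^+ 2 - 8) = 8 * (Z1 ^+ 2 + 2 * (2 * q + 1)).
  apply: (mulfI a0); rewrite zE in E.
  have -> : a ^+ 2 * (y ^+ 2 * ((2 * q + 1) * a ^+ 2 - 8)) =
      ((2 * q + 1) * a ^+ 2 - 8) * (a ^+ 2 * y ^+ 2 - 16)
      + 16 * ((2 * q + 1) * a ^+ 2 - 8) by ring.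
  by rewrite E; ring.
(* With p = 2 q + 1, the factor p a^2 - 8 is odd, so y = 4 y2. After halving, y2^2 (p a^2 - 8) = 2
   Z2^2 + p with y2 odd; modulo 8 this forces Z2 to be even, and the witnesses are Y = y / 4 and Z =
   z / (4 a). *)
have [y1 [yE|yE]] := even_or_odd y; rewrite yE in E; last first.
  have [u uE] := odd_square y1. rewrite uE tE in E; lia.
have [y2 [y1E|y1E]] := even_or_odd y1; rewrite y1E in E; last first.
  have [u uE] := odd_square y2. rewrite exprMn uE tE in E. lia.
have {}E : 2 * (y2 ^+ 2 * ((2 * q + 1) * a ^+ 2 - 8)) = Z1 ^+ 2 + 2 * (2 * q + 1).
  by apply: (@mulfI _ 8) => //; rewrite -E; ring.
have [Z2 [Z1E|Z1E]] := even_or_odd Z1; rewrite Z1E in E; last by clear - E; lia.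
have {}E : y2 ^+ 2 * ((2 * q + 1) * a ^+ 2 - 8) = 2 * Z2 ^+ 2 + (2 * q + 1).
  by apply: (@mulfI _ 2) => //; rewrite E; ring.
rewrite tE in E.
have [y3 [y2E|y2E]] := even_or_odd y2; first by rewrite y2E in E; clear - E; lia.
have [u uE] := odd_square y3; rewrite -y2E in uE.
have [Z [Z2E|Z2E]] := even_or_odd Z2; last by rewrite uE Z2E in E; clear - E; lia.
by exists y2, Z; rewrite mulrC tE E Z2E; ring.
Qed.

Lemma mod3_cases (a : int) : exists b, [\/ a = 3 * b, a = 3 * b + 1 | a = 3 * b + 2].
Proof.
exists (a %/ 3)%Z; set b := (a %/ 3)%Z.
have : a = 3 * b \/ a = 3 * b + 1 \/ a = 3 * b + 2 by rewrite /b; lia.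
by case=> [|[]]; [apply: Or31|apply: Or32|apply: Or33].
Qed.

Lemma sqr_ne2_mod3 (a t : int) : a ^+ 2 <> 3 * t + 2.
Proof. by have [b [->|->|->]] := mod3_cases a; lia. Qed.

Lemma mod7_cases (a : int) : exists b c : int, a = 7 * b + c /\ (0 <= c < 7).
Proof. exists (a %/ 7)%Z, (a %% 7)%Z; lia. Qed.

Lemma mod7_sqr (a t c : int) : a ^+ 2 = 7 * t + c -> c \notin [:: 3; 5; 6].
Proof.
have [b [r [-> r7]]] := mod7_cases a.
have : r \in [:: 0; 1; 2; 3; 4; 5; 6 : int].
  by case: r r7 => // -[|[|[|[|[|[|[|?]]]]]]].
rewrite !inE => + E; move=> {}r7; apply/negP => c7; move: r7.
do ![case/orP]; move/eqP=> rE; rewrite rE in E; clear - c7 E; lia.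
Qed.

(* The case p = 7, (d1, d2) = (7, 2): z and y are divisible by 7, whence -2 is a
   square modulo 7. *)
Lemma no_solution_7_2 (a b y z : int) :
  7 * a ^+ 2 + 1 = 2 * b ^+ 2 ->
  (49 * a ^+ 2 - 8) * (7 * a ^+ 2 * y ^+ 2 - 16) <> 8 * (z ^+ 2 + 16).
Proof.
move=> eb E.
have [c [aE|aE]] := even_or_odd a; first by rewrite aE in eb; lia.
have /dvdzP[w zE] : (a %| z)%Z.
  rewrite aE; apply: (@odd_dvd_of_sq _ _ (343 * a ^+ 2 * y ^+ 2 - 784 - 56 * y ^+ 2)).
  by rewrite -aE; apply: (addIr 128); rewrite -[RHS](mulrDr 8 _ 16) -E; ring.
have a0 : a ^+ 2 != 0 by lia.
have {}E : 343 * a ^+ 2 * y ^+ 2 - 784 - 56 * y ^+ 2 = 8 * w ^+ 2.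
  apply: (mulfI a0); apply: (addIr 128).
  have -> : a ^+ 2 * (8 * w ^+ 2) + 128 = 8 * (z ^+ 2 + 16) by rewrite zE; ring.
  by rewrite -E; ring.
have /dvdzP[u wE] : (7 %| w)%Z.
  apply: (@dvdz_sqr_prime 7) => //; apply/dvdzP.
  by exists (49 * a ^+ 2 * y ^+ 2 - 112 - 8 * y ^+ 2 - w ^+ 2); lia.
rewrite wE in E.
have /dvdzP[v yE] : (7 %| y)%Z.
  apply: (@dvdz_sqr_prime 7) => //; apply/dvdzP.
  by exists (7 * a ^+ 2 * y ^+ 2 - 16 - y ^+ 2 - 8 * u ^+ 2); lia.
rewrite yE in E.
suff : 5 \notin [:: 3; 5; 6 : int] by [].
apply: (@mod7_sqr u (49 * a ^+ 2 * v ^+ 2 - 8 * v ^+ 2 - u ^+ 2 - 3)).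
by clear - E; lia.
Qed.

(* The case s' = 6, s = 18 a^2: z and y are divisible by 3, whence -1 is a square
   modulo 3. *)
Lemma no_solution_3_1 (a b y z : int) : a != 0 ->
  (18 * a ^+ 2 - 8) * (3 * a ^+ 2 * y ^+ 2 - 16) <> 8 * (z ^+ 2 + 16).
Proof.
move=> a0 E; have a20 : a ^+ 2 != 0 by rewrite expf_neq0.
(* As a may be even here, divisibility by a is obtained for 2 z rather than for z. *)
have E1 : a ^+ 2 * (27 * a ^+ 2 * y ^+ 2 - 144 - 12 * y ^+ 2) = (2 * z) ^+ 2.
  apply: (@mulfI _ 2) => //; apply: (addIr 128).
  have -> : 2 * (2 * z) ^+ 2 + 128 = 8 * (z ^+ 2 + 16) by ring.
  by rewrite -E; ring.
have /dvdzP[w zE] : (a %| 2 * z)%Z.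
  have : (a ^+ 2 %| (2 * z) ^+ 2)%Z by rewrite -E1 dvdz_mulr.
  by rewrite dvdz_sqr.
have {}E : 27 * a ^+ 2 * y ^+ 2 - 144 - 12 * y ^+ 2 = w ^+ 2.
  by apply: (mulfI a20); rewrite E1 zE; ring.
have /dvdzP[u wE] : (3 %| w)%Z.
  apply: (@dvdz_sqr_prime 3) => //; apply/dvdzP.
  by exists (9 * a ^+ 2 * y ^+ 2 - 48 - 4 * y ^+ 2); lia.
rewrite wE in E.
have /dvdzP[v yE] : (3 %| y)%Z.
  apply: (@dvdz_sqr_prime 3) => //; apply/dvdzP.
  by exists (3 * a ^+ 2 * y ^+ 2 - 16 - y ^+ 2 - u ^+ 2); lia.
rewrite yE in E.
apply: (@sqr_ne2_mod3 u (9 * a ^+ 2 * v ^+ 2 - 4 * v ^+ 2 - 6)); clear - E; lia.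
Qed.

(** * The odd values of s' up to 8 *)

Lemma int_square_descent (p : nat) (S w : int) :
  odd p -> (p == 1%N) || prime p -> 0 < S ->
  2 * p%:Z * S * (S + p%:Z) = w ^+ 2 ->
  exists (d1 d2 : nat) (a b : int), [/\ (d1 * d2 = 2 * p)%N,
    S = p%:Z * (d1%:Z * a ^+ 2) & d1%:Z * a ^+ 2 + 1 = d2%:Z * b ^+ 2].
Proof.
move=> op p1 S0 e.
have p0 : p%:Z != 0 by case: p op {p1 e}.
have SE : S = `|S|%N by lia.
have [||d1 [d2 [a [b [dE sE sE']]]]] := square_descent p `|S|%N `|w|%N op p1.
- lia.
- by rewrite SE (sqr_absz w) in e; clear - e; lia.
have {}sE : S = p%:Z * (d1%:Z * a%:Z ^+ 2) by rewrite SE {1}sE; lia.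
exists d1, d2, a, b; split=> //; apply: (mulfI p0).
by rewrite mulrDr -sE mulr1 SE -PoszD sE'; lia.
Qed.

(** The descent gives S = p d1 a^2 and k = d1 a^2 y^2, and the divisors d1 of 2 p are treated one by
    one; only d1 = 1 survives. *)
Lemma small_odd (p : nat) (S k y z w : int) :
  p \in [:: 1; 3; 5; 7]%N -> 8 < S ->
  (S - 8) * (k - 16) = 8 * (z ^+ 2 + 16) -> p%:Z * k = y ^+ 2 * S ->
  2 * p%:Z * S * (S + p%:Z) = w ^+ 2 ->
  ((p == 1) || (p == 5))%N /\
  exists m n Y Z, [/\ S = p%:Z * m ^+ 2, m ^+ 2 - 2 * p%:Z * n ^+ 2 = -1
    & (p%:Z * m ^+ 2 - 8) * Y ^+ 2 = p%:Z + 8 * Z ^+ 2].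
Proof.
move=> pP S8 E kE eS.
have op : odd p by move: pP; rewrite !inE => /or4P[] /eqP->.
have p1 : (p == 1%N) || prime p by move: pP; rewrite !inE => /or4P[] /eqP->.
have S0 : 0 < S by lia.
have [d1 [d2 [a [b [dE SE ab]]]]] := int_square_descent p S w op p1 S0 eS.
have {}kE : k = d1%:Z * a ^+ 2 * y ^+ 2.
  have p0 : p%:Z != 0 by case: p op {p1 pP eS SE dE kE}.
  by apply: (mulfI p0); rewrite kE SE; ring.
have [q pq] : exists q : nat, p = (2 * q + 1)%N by exists p./2; clear - op; lia.
have pqZ : p%:Z = 2 * q%:Z + 1 by clear - pq; lia.
have [d1E|d1E] := eqVneq d1 (2 * p)%N.
  have d2E : d2 = 1%N by clear - dE d1E op; nia.
  have d1Z : d1%:Z = 2 * (2 * q%:Z + 1) by clear - d1E pq; lia.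
  exfalso; rewrite d1Z pqZ d2E in SE ab kE.
  apply: (@no_solution_2p_1 q a b y z).
  - by rewrite ab mul1r.
  - by move: S8; rewrite SE; congr (_ < _); ring.
  - by rewrite -E kE SE; ring.
have [d1E'|d1E'] := eqVneq d1 1%N.
  have d2E : d2 = (2 * p)%N by clear - dE d1E'; lia.
  rewrite d1E' d2E in SE ab kE; rewrite !mul1r in SE ab kE.
  have [Y [Z YZ]] : exists Y Z,
      ((2 * q%:Z + 1) * a ^+ 2 - 8) * Y ^+ 2 = (2 * q%:Z + 1) + 8 * Z ^+ 2.
    apply: (@solution_1_2p q a b y z); first by rewrite ab -pqZ; clear; lia.
    by rewrite -E SE kE -pqZ.
  split; last by exists a, b, Y, Z; split=> //; [clear - ab; lia | rewrite pqZ].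
  (* Here a^2 = -1 modulo 2 p, and -1 is not a square modulo 3 or 7. *)
  move: pP; rewrite !inE => /or4P[] /eqP pE; rewrite ?pE //; rewrite pE in ab.
    by exfalso; apply: (@sqr_ne2_mod3 a (2 * b ^+ 2 - 1)); clear - ab; lia.
  suff : 6 \notin [:: 3; 5; 6 : int] by [].
  by apply: (@mod7_sqr a (2 * b ^+ 2 - 1)); clear - ab; lia.
have d1le : (d1 <= 2 * p)%N.
  by rewrite dvdn_leq //; [clear - op; lia | rewrite -dE dvdn_mulr].
(* For p > 1 the divisors left are 2 and p. All but (p, d1) = (3, 2) and (7, 7) contradict d1 a^2 +
   1 = d2 b^2 modulo 8. *)
exfalso; move: pP; rewrite !inE => /or4P[] /eqP pE; rewrite pE in SE dE d1E d1le;
  clear pqZ pq.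
- by case: d1 {SE ab kE} d1le dE d1E d1E' => [|[|[|?]]].
- have [[d1F d2F]|[d1F d2F]] : (d1 = 2 /\ d2 = 3)%N \/ (d1 = 3 /\ d2 = 2)%N.
    by case: d1 {SE ab kE} d1le dE d1E d1E' => [|[|[|[|[|[|[|?]]]]]]] //; clear; lia.
  + rewrite d1F d2F in SE ab kE.
    have [c [aE|aE]] := even_or_odd a.
      have [f [bE|bE]] := even_or_odd b; rewrite aE bE in ab; clear - ab; lia.
    have [t tE] := odd_square c; rewrite -aE in tE; rewrite tE in SE.
    (* S = 6 a^2 with a odd, so (S - 8) / 2 = 3 (8 t + 1) - 4 is 3 modulo 4. *)
    apply: (@dvd_3mod4 (3 * (8 * t + 1) - 4) (2 * (k - 16)) z).
    * by clear - S8 SE; lia.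
    * by clear; lia.
    * by rewrite -E SE; ring.
  + rewrite d1F d2F in ab.
    have [t aE] := square_mod8 a; have [u bE] := square_mod8 b.
    by case: aE => aE; case: bE => bE; clear - ab aE bE; lia.
- have [[d1F d2F]|[d1F d2F]] : (d1 = 2 /\ d2 = 5)%N \/ (d1 = 5 /\ d2 = 2)%N.
    by case: d1 {SE ab kE} d1le dE d1E d1E'
      => [|[|[|[|[|[|[|[|[|[|[|?]]]]]]]]]]] //; clear; lia.
  + rewrite d1F d2F in ab.
    have [t aE] := square_mod8 a; have [u bE] := square_mod8 b.
    by case: aE => aE; case: bE => bE; clear - ab aE bE; lia.
  + rewrite d1F d2F in ab.
    have [t aE] := square_mod8 a; have [u bE] := square_mod8 b.
    by case: aE => aE; case: bE => bE; clear - ab aE bE; lia.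
- have [[d1F d2F]|[d1F d2F]] : (d1 = 2 /\ d2 = 7)%N \/ (d1 = 7 /\ d2 = 2)%N.
    by case: d1 {SE ab kE} d1le dE d1E d1E'
      => [|[|[|[|[|[|[|[|[|[|[|[|[|[|[|?]]]]]]]]]]]]]]] //; clear; lia.
  + rewrite d1F d2F in ab.
    have [t aE] := square_mod8 a; have [u bE] := square_mod8 b.
    by case: aE => aE; case: bE => bE; clear - ab aE bE; lia.
  + rewrite d1F d2F in SE ab kE; apply: (@no_solution_7_2 a b y z) => //.
    by rewrite -E SE kE; congr ((_ - _) * _); ring.
Qed.

(** * The even values of s' up to 8 *)

(** The only candidate between (2 S)^2 and (2 S + 2)^2 is (2 S + 1)^2, which is odd. *)
Lemma no_square_2 (S w : int) : 0 < S -> 4 * S * (S + 2) <> w ^+ 2.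
Proof.
move=> S0 E; have wE : w ^+ 2 = `|w| ^+ 2 by rewrite real_normK ?num_real.
have : 2 * S < `|w| by rewrite -ltr_sqr ?nnegrE -?wE -?E //; clear - S0; lia.
have : `|w| < 2 * S + 2 by rewrite -ltr_sqr ?nnegrE -?wE -?E //; clear - S0; lia.
rewrite wE in E; move=> w1 w2; have e : `|w| = 2 * S + 1 by clear - w1 w2; lia.
by rewrite e in E; clear - E; lia.
Qed.

(** Writing |w| = 4 S + i with i < 16 turns the equation into i^2 = 8 S (16 - i), which fails for
    each i when S > 8. *)
Lemma no_square_8 (S w : int) : 8 < S -> 16 * S * (S + 8) <> w ^+ 2.
Proof.
move=> S0 E; have wE : w ^+ 2 = `|w| ^+ 2 by rewrite real_normK ?num_real.
have w1 : 4 * S < `|w| by rewrite -ltr_sqr ?nnegrE -?wE -?E //; clear - S0; lia.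
have w2 : `|w| < 4 * S + 16 by rewrite -ltr_sqr ?nnegrE -?wE -?E //; clear - S0; lia.
have [i iE] : exists i : nat, `|w| = 4 * S + i%:Z.
  by exists `|(`|w| - 4 * S)%R|%N; clear - w1; lia.
have {w1}w2 : (i < 16)%N by clear - iE w2; lia.
rewrite wE {}iE in E; clear wE w.
by do 16?[case: i w2 E => [|i] w2 E; first by clear - S0 E; lia].
Qed.

(** Removing powers of 2 gives S = 4 r with 2 r (r + 1) a square, which is the descent for p = 1.
    Then S - 8 is 4 (r - 2) with r an odd square, or 8 (4 c^2 - 1); both have a factor that is 3
    modulo 4. *)
Lemma no_solution_4 (S k y z w : int) :
  8 < S -> (S - 8) * (k - 16) = 8 * (z ^+ 2 + 16) -> 4 * k = y ^+ 2 * S ->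
  8 * S * (S + 4) <> w ^+ 2.
Proof.
move=> S8 E kE eS.
have [w1 [wE|wE]] := even_or_odd w; rewrite wE in eS; last by clear - eS; lia.
have {wE}eS : 2 * S * (S + 4) = w1 ^+ 2 by clear - eS; lia.
have [w2 [wE|wE]] := even_or_odd w1; rewrite wE in eS; last by clear - eS; lia.
have {wE}eS : S * (S + 4) = 2 * w2 ^+ 2 by clear - eS; lia.
have [s [SE|SE]] := even_or_odd S; rewrite SE in eS; last by clear - eS; lia.
have {}eS : 2 * (s * (s + 2)) = w2 ^+ 2 by clear - eS; lia.
have [w3 [wE|wE]] := even_or_odd w2; rewrite wE in eS; last by clear - eS; lia.
have {wE}eS : s * (s + 2) = 2 * w3 ^+ 2 by clear - eS; lia.
have [r [sE|sE]] := even_or_odd s; rewrite sE in eS; last by clear - eS; lia.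
have {}eS : 2 * 1%:Z * r * (r + 1) = w3 ^+ 2 by clear - eS; lia.
have r0 : 0 < r by clear - SE sE S8; lia.
have {SE sE}SE : S = 4 * r by rewrite SE sE; ring.
have {}kE : k = y ^+ 2 * r by apply: (@mulfI _ 4) => //; rewrite kE SE; ring.
have [d1 [d2 [a [b [dE rE ab]]]]] := @int_square_descent 1 r w3 isT isT r0 eS.
rewrite mul1r in rE.
have [[d1F d2F]|[d1F d2F]] : (d1 = 1 /\ d2 = 2)%N \/ (d1 = 2 /\ d2 = 1)%N.
  by case: d1 {rE ab} dE => [|[|[|?]]]; clear; lia.
- rewrite d1F d2F !mul1r in rE ab.
  have [c [aE|aE]] := even_or_odd a; first by rewrite aE in ab; clear - ab; lia.
  have [t tE] := odd_square c; rewrite -aE -rE in tE.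
  apply: (@dvd_3mod4 (r - 2) (4 * (k - 16)) z); [|clear - tE; lia|].
    by clear - S8 SE tE; lia.
  by rewrite -E SE; ring.
- rewrite d1F d2F in rE ab.
  have [c [aE|aE]] := even_or_odd a; last first.
    have [f [bE|bE]] := even_or_odd b; rewrite aE bE in ab; clear - ab; lia.
  rewrite aE in rE.
  apply: (@dvd_3mod4 (4 * c ^+ 2 - 1) (8 * (k - 16)) z); [|clear; lia|].
    by clear - SE S8 rE; lia.
  by rewrite -E SE rE; ring.
Qed.

Lemma coprime_mul_square_3 (u v t : nat) :
  coprime u v -> (3 * (u * v) = t ^ 2)%N -> exists a b,
  (u = a ^ 2 /\ v = 3 * b ^ 2)%N \/ (u = 3 * a ^ 2 /\ v = b ^ 2)%N.
Proof.
move=> cop e.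
have d3 : (3 %| t)%N.
  suff : (3 %| t ^ 2)%N by rewrite Euclid_dvdX // => /andP[].
  by rewrite -e dvdn_mulr.
have [d1 [d2 [a [b [dE -> ->]]]]] := coprime_mul_square_mul 3 _ _ _ isT cop d3 e.
exists a, b.
have d13 : (d1 <= 3)%N by rewrite dvdn_leq // -dE dvdn_mulr.
case: d1 d13 dE => [|[|[|[|d1]]]] // _ dE.
- by left; have -> : (d2 = 3)%N; clear - dE; lia.
- by clear - dE; lia.
- by right; have -> : (d2 = 1)%N; clear - dE; lia.
Qed.

(** Here S = 3 n with 3 n (n + 2) a square. The coprime factors are m and m + 1 if n = 2 m, and n
    and n + 2 if n is odd; one is a square, the other three times a square. Modulo 3 only S = 18 a^2
    (n even) and S = 3 a^2 with a odd remain, and in the latter S - 8 is 3 modulo 4. *)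
Lemma no_solution_6 (S k y z w : int) :
  8 < S -> (S - 8) * (k - 16) = 8 * (z ^+ 2 + 16) -> 6 * k = y ^+ 2 * S ->
  12 * S * (S + 6) <> w ^+ 2.
Proof.
move=> S8 E kE eS.
have [w1 [wE|wE]] := even_or_odd w; rewrite wE in eS; last by clear - eS; lia.
have {wE}eS : 3 * S * (S + 6) = w1 ^+ 2 by clear - eS; lia.
have /dvdzP[w2 wE] : (3 %| w1)%Z.
  by apply: (@dvdz_sqr_prime 3) => //; rewrite -eS -mulrA dvdz_mulr.
have /dvdzP[s SE] : (3 %| S)%Z.
  apply: (@dvdz_sqr_prime 3) => //; apply/dvdzP.
  by exists (w2 ^+ 2 - 2 * S); rewrite wE in eS; clear - eS; lia.
have {wE}eS : 3 * s * (s + 2) = w2 ^+ 2 by rewrite SE wE in eS; clear - eS; lia.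
have [n sE] : exists n : nat, s = n%:Z by exists `|s|%N; clear - SE S8; lia.
have {}eS : (3 * (n * (n + 2)) = `|w2| ^ 2)%N.
  by rewrite (sqr_absz w2) sE in eS; clear - eS; lia.
have {s sE}SE : S = 3 * n%:Z by rewrite SE sE; ring.
have [m nE] : exists m, n = (2 * m)%N \/ n = (2 * m + 1)%N by exists n./2; clear; lia.
case: nE => nE.
  have [w3 wE] : exists t, (`|w2| = 2 * t)%N.
    have : (2 %| `|w2| ^ 2)%N by rewrite -eS nE mulnCA -!mulnA dvdn_mulr.
    by rewrite Euclid_dvdX // => /andP[/dvdnP[t ->] _]; exists t; rewrite mulnC.
  have {}eS : (3 * (m * (m + 1)) = w3 ^ 2)%N by rewrite wE nE in eS; clear - eS; lia.
  have cop : coprime m (m + 1) by rewrite addn1 coprimenS.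
  have [a [b [[mE mE']|[mE mE']]]] := coprime_mul_square_3 _ _ _ cop eS.
    by apply: (@sqr_ne2_mod3 a%:Z (b%:Z ^+ 2 - 1)); clear - mE mE'; lia.
  have {}SE : S = 18 * a%:Z ^+ 2 by rewrite SE nE mE; clear; lia.
  apply: (@no_solution_3_1 a b y z); first by clear - SE S8; lia.
  have kE' : k = 3 * a%:Z ^+ 2 * y ^+ 2.
    by apply: (@mulfI _ 6) => //; rewrite kE SE; ring.
  by rewrite -E SE kE'; ring.
have cop : coprime n (n + 2).
  by rewrite /coprime gcdnDl -/(coprime n 2) coprimen2 nE; clear; lia.
have [a [b [[mE mE']|[mE mE']]]] := coprime_mul_square_3 _ _ _ cop eS; last first.
  by apply: (@sqr_ne2_mod3 b%:Z (a%:Z ^+ 2)); clear - mE mE'; lia.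
have [c aE] : exists c : int, a%:Z = 2 * c + 1.
  have [c [aE|aE]] := even_or_odd a%:Z; last by exists c.
  by clear - mE nE aE; lia.
have [t tE] := odd_square c; rewrite -aE in tE.
apply: (@dvd_3mod4 (3 * a%:Z ^+ 2 - 8) (k - 16) z).
- by clear - SE S8 mE; lia.
- by rewrite tE; clear; lia.
- by rewrite -E SE mE; congr (_ * _); clear; lia.
Qed.

(** * Finite searches for s' > 8 *)

(* The alternative [s' <= 8] is included because the search below does not
   exclude it; those values of s' are treated by descent. *)
Definition exceptional (s s' : Z) : bool :=
  (s' <=? 8)%BZ ||
  has (fun p => (s =? p.1)%BZ && (s' =? p.2)%BZ)
    [:: (9, 9); (12, 24); (16, 16); (24, 12); (10, 40); (40, 10); (18, 32)]%BZ.

(** The search runs over h = k - 16 < 200, z <= y z < k and y <= (k - 1) / z. The integrality of x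
    enters through 2 k (s + s') = (4 x)^2. *)
Lemma small_k_check :
  all (fun k0 => all (fun z0 =>
    let z := Z.of_nat z0 in
    let k := (Z.of_nat k0 + 16)%BZ in
    let t := (8 * (z * z + 16))%BZ in
    if (t mod Z.of_nat k0 =? 0)%BZ then
      let s := (t / Z.of_nat k0 + 8)%BZ in
      all (fun y0 =>
        let y := Z.of_nat y0 in
        let u := (y * y * s)%BZ in
        if (u mod k =? 0)%BZ then
          let s' := (u / k)%BZ in
          let r := (2 * k * (s + s'))%BZ in
          if (Z.sqrt r * Z.sqrt r =? r)%BZ then exceptional s s' else true
        else true) (iota 1 (Z.to_nat ((k - 1) / z)))
    else true) (iota 1 (k0 + 15))) (iota 1 199).
Proof. by vm_compute. Qed.

(** The range 208 comes from the extreme case t' = 1, where the inequality reads 72 t < 14976, that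
    is t < 208. *)
Lemma large_k_check :
  all (fun t0 => all (fun t0' =>
    let t := Z.of_nat t0 in let t' := Z.of_nat t0' in
    if (200 * (t * t' - 64) <? 128 * (t + t' + 16))%BZ then
      let s := (t + 8)%BZ in let s' := (t' + 8)%BZ in
      let r := (2 * s * s' * (s + s'))%BZ in
      if (Z.sqrt r * Z.sqrt r =? r)%BZ then
        [|| exceptional s s', (s =? 9)%BZ && (s' =? 72)%BZ
          | (s =? 72)%BZ && (s' =? 9)%BZ]
      else true
    else true) (iota 1 208)) (iota 1 208).
Proof. by vm_compute. Qed.

Lemma all_iota1P (f : pred nat) n i : all f (iota 1 n) -> (0 < i <= n)%N -> f i.
Proof. by move/allP => fP i_n; apply: fP; rewrite mem_iota; lia. Qed.

Lemma exceptionalP (s s' : nat) : exceptional (Z.of_nat s) (Z.of_nat s') ->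
  (s' <= 8)%N \/ (s, s') \in
    [:: (9, 9); (12, 24); (16, 16); (24, 12); (10, 40); (40, 10); (18, 32)]%N.
Proof.
rewrite /exceptional /= !inE !xpair_eqE orbF => /orP[h|h]; first by left; lia.
by right; lia.
Qed.

Lemma small_k (h t s' y z x : nat) :
  (0 < h < 200)%N -> (0 < y)%N -> (0 < z)%N -> (y * z < h + 16)%N ->
  (t * h = 8 * (z ^ 2 + 16))%N -> (s' * (h + 16) = y ^ 2 * (t + 8))%N ->
  (8 * x ^ 2 = (h + 16) * (t + 8 + s'))%N ->
  exceptional (Z.of_nat (t + 8)) (Z.of_nat s').
Proof.
move=> h_lt y0 z0 yz tE s'E xE.
have {}h_lt : (0 < h <= 199)%N by clear - h_lt; lia.
have zh : (0 < z <= h + 15)%N by clear - z0 y0 yz; nia.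
have {zh} := all_iota1P _ _ _ (all_iota1P _ _ _ small_k_check h_lt) zh.
cbv beta zeta; set k := (Z.of_nat h + 16)%BZ; set u := (8 * _)%BZ.
have uE : u = (Z.of_nat t * Z.of_nat h)%BZ by rewrite /u; clear - tE; nia.
have h0 : Z.of_nat h <> 0%BZ by clear - h_lt; lia.
rewrite uE Z.mod_mul // Z.div_mul // => small.
have yk : (0 < y <= Z.to_nat ((k - 1) / Z.of_nat z))%N.
  apply/andP; split => //.
  suff : (Z.of_nat y <= (k - 1) / Z.of_nat z)%BZ by clear; lia.
  by apply: Z.div_le_lower_bound; rewrite /k; clear - yz z0; nia.
have {small yk} := all_iota1P _ _ _ small yk; cbv beta zeta.
set v := (Z.of_nat y * _ * _)%BZ.
have vE : v = (Z.of_nat s' * k)%BZ by rewrite /v /k; clear - s'E; nia.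
have k0 : k <> 0%BZ by rewrite /k; clear; lia.
rewrite vE Z.mod_mul // Z.div_mul //.
set r := (2 * k * _)%BZ.
have rE : r = (Z.of_nat (4 * x) * Z.of_nat (4 * x))%BZ.
  by rewrite /r /k; clear - xE; nia.
rewrite rE Z.sqrt_square; last by clear; lia.
rewrite !Z.eqb_refl; congr exceptional; clear; lia.
Qed.

Lemma large_k (t t' w : nat) :
  (0 < t)%N -> (0 < t')%N -> (200 * (t * t') < 128 * (t + t' + 16) + 200 * 64)%N ->
  (2 * (t + 8) * (t' + 8) * (t + 8 + (t' + 8)) = w ^ 2)%N ->
  [\/ exceptional (Z.of_nat (t + 8)) (Z.of_nat (t' + 8)),
      t = 1%N /\ t' = 64%N | t = 64%N /\ t' = 1%N].
Proof.
move=> t0 t'0 tt' wE.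
have t208 : (0 < t <= 208)%N by clear - t0 t'0 tt'; nia.
have t'208 : (0 < t' <= 208)%N by clear - t0 t'0 tt'; nia.
have := all_iota1P _ _ _ (all_iota1P _ _ _ large_k_check t208) t'208; cbv beta zeta.
have -> : (200 * (Z.of_nat t * Z.of_nat t' - 64) <?
    128 * (Z.of_nat t + Z.of_nat t' + 16))%BZ = true.
  by clear - tt'; lia.
set r := (2 * _ * _ * _)%BZ.
have rE : r = (Z.of_nat w * Z.of_nat w)%BZ by rewrite /r; clear - wE; nia.
rewrite rE Z.sqrt_square; last by clear; lia.
rewrite Z.eqb_refl => /or3P[e|e|e].
- by apply: Or31; move: e; congr exceptional; clear; lia.
- by apply: Or32; clear - e; lia.
- by apply: Or33; clear - e; lia.
Qed.

(** * Reduction of the integer problem to the searches and the descents *)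

(** The product times k^2 is 2 s (y^2 s) (8 x^2) = (4 x y s)^2, so k divides 4 x y s. *)
Lemma square_product (s s' k y x : int) : 0 < k -> s' * k = y ^+ 2 * s ->
  8 * x ^+ 2 = k * (s + s') -> exists w, 2 * s * s' * (s + s') = w ^+ 2.
Proof.
move=> k0 s'E xE.
have e : k ^+ 2 * (2 * s * s' * (s + s')) = (4 * x * y * s) ^+ 2.
  have -> : (4 * x * y * s) ^+ 2 = 2 * s * (y ^+ 2 * s) * (8 * x ^+ 2) by ring.
  by rewrite -s'E xE; ring.
have /dvdzP[w wE] : (k %| 4 * x * y * s)%Z.
  have : (k ^+ 2 %| (4 * x * y * s) ^+ 2)%Z by rewrite -e dvdz_mulr.
  by rewrite dvdz_sqr.
exists w; have k20 : k ^+ 2 != 0 by rewrite expf_neq0 // gt_eqF.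
by apply: (mulfI k20); rewrite e wE; ring.
Qed.

(** Multiplying (y z)^2 < k^2 by s and cancelling k gives s' z^2 < k s; substituting 8 z^2 = t h -
    128 and expanding yields the bound. *)
Lemma size_bound (t t' h y z : int) : 0 < y -> 0 < z -> 0 < t -> 0 < h ->
  y * z < h + 16 -> t * h = 8 * (z ^+ 2 + 16) ->
  (t' + 8) * (h + 16) = y ^+ 2 * (t + 8) ->
  h * (t * t' - 64) < 128 * (t + t' + 16).
Proof.
move=> y0 z0 t0 h0 yz tE s'E.
have k0 : 0 < h + 16 by clear - h0; lia.
have yz2 : (y * z) ^+ 2 < (h + 16) ^+ 2.
  by rewrite ltr_sqr ?nnegrE ?mulr_ge0 ?ltW.
have : (h + 16) * ((t' + 8) * z ^+ 2) < (h + 16) * ((h + 16) * (t + 8)).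
  have -> : (h + 16) * ((t' + 8) * z ^+ 2) = (y * z) ^+ 2 * (t + 8).
    by rewrite exprMn mulrAC -s'E; ring.
  rewrite mulrA -expr2 ltr_pM2r //; clear - t0; lia.
rewrite ltr_pM2l // => main.
have : (t' + 8) * (t * h - 128) < 8 * ((h + 16) * (t + 8)).
  have -> : (t' + 8) * (t * h - 128) = 8 * ((t' + 8) * z ^+ 2) by rewrite tE; ring.
  by rewrite ltr_pM2l.
clear; lia.
Qed.

(** Here y = 8 c and c^2 - z^2 = 18, but a difference of two squares is never 2 modulo 4. *)
Lemma no_solution_9_72 (y z k : int) :
  k - 16 = 8 * (z ^+ 2 + 16) -> 72 * k = y ^+ 2 * 9 -> False.
Proof.
move=> kE yE; have {kE}kE : k = 8 * (z ^+ 2 + 16) + 16 by clear - kE; lia.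
have {}yE : y ^+ 2 = 64 * (z ^+ 2 + 18) by rewrite kE in yE; clear - yE; lia.
have [a [aE|aE]] := even_or_odd y; rewrite aE in yE; last by clear - yE; lia.
have [b [bE|bE]] := even_or_odd a; rewrite bE in yE; last by clear - yE; lia.
have [c [cE|cE]] := even_or_odd b; rewrite cE in yE; last by clear - yE; lia.
have [d [dE|dE]] := even_or_odd c; have [e [eE|eE]] := even_or_odd z;
  rewrite dE eE in yE; clear - yE; lia.
Qed.

(** Here z = 4 b and b^2 = 4 y^2 - 9, which is 3 modulo 4. *)
Lemma no_solution_72_9 (y z k : int) :
  64 * (k - 16) = 8 * (z ^+ 2 + 16) -> 9 * k = y ^+ 2 * 72 -> False.
Proof.
move=> zE yE; have {yE}kE : k = 8 * y ^+ 2 by clear - yE; lia.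
have {}zE : z ^+ 2 = 64 * y ^+ 2 - 144 by rewrite kE in zE; clear - zE; lia.
have [a [aE|aE]] := even_or_odd z; rewrite aE in zE; last by clear - zE; lia.
have [b [bE|bE]] := even_or_odd a; rewrite bE in zE; last by clear - zE; lia.
have [c [cE|cE]] := even_or_odd b; rewrite cE in zE; clear - zE; lia.
Qed.

(** The parameter p merges the last two alternatives of the theorem: p = 5 is (b) and p = 1 is
    (c). *)
Lemma integer_classification (y z k s s' x : int) :
  0 < y -> 0 < z -> 16 < k -> y * z < k ->
  (s - 8) * (k - 16) = 8 * (z ^+ 2 + 16) -> s' * k = y ^+ 2 * s ->
  8 * x ^+ 2 = k * (s + s') ->
  (s, s') \in [:: (9, 9); (12, 24); (16, 16); (24, 12);
                  (10, 40); (40, 10); (18, 32)] \/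
  exists p m n Y Z, [/\ p \in [:: 1; 5], s = p * m ^+ 2, s' = p,
    m ^+ 2 - 2 * p * n ^+ 2 = -1 & (p * m ^+ 2 - 8) * Y ^+ 2 = p + 8 * Z ^+ 2].
Proof.
move=> y0 z0 k16 yz sE s'E xE.
have k0 : 0 < k by clear - k16; lia.
have s8 : 8 < s.
  rewrite -subr_gt0 -(@pmulr_lgt0 _ (k - 16)) ?subr_gt0 // sE.
  by have := sqr_ge0 z; clear; lia.
have s0 : 0 < s by clear - s8; lia.
have s'0 : 0 < s' by rewrite -(@pmulr_lgt0 _ k) // s'E mulr_gt0 ?exprn_gt0.
have [w wE] := square_product _ _ _ _ _ k0 s'E xE.
have [s'8|s'8] := lerP s' 8.
  right.
  have odd_case (p : nat) : p \in [:: 1; 3; 5; 7]%N -> s' = p%:Z ->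
      exists p m n Y Z, [/\ p \in [:: 1; 5], s = p * m ^+ 2, s' = p,
    m ^+ 2 - 2 * p * n ^+ 2 = -1 & (p * m ^+ 2 - 8) * Y ^+ 2 = p + 8 * Z ^+ 2].
    move=> pP pE; rewrite pE in s'E wE.
    have e : 2 * p%:Z * s * (s + p%:Z) = w ^+ 2 by rewrite -wE; ring.
    have [p15 [m [n [Y [Z [? ? ?]]]]]] := small_odd _ _ _ _ _ _ pP s8 sE s'E e.
    by exists p%:Z, m, n, Y, Z; split=> //; rewrite !inE; clear - p15; lia.
  have {s'8} : [\/ exists2 p : nat, p \in [:: 1; 3; 5; 7]%N & s' = p%:Z,
      s' = 2, s' = 4 | s' = 6 \/ s' = 8].
    case: s' s'8 s'0 {s'E xE wE odd_case} => // -[|[|[|[|[|[|[|[|[|?]]]]]]]]] // _ _;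
      first [ by apply: Or41; eexists; last reflexivity | by apply: Or42
            | by apply: Or43 | by apply: Or44; auto ].
  case=> [[p pP pE]|e|e|[e|e]]; first exact: odd_case pP pE;
    exfalso; rewrite e in s'E wE.
  - by apply: (@no_square_2 s w) => //; rewrite -wE; ring.
  - by apply: (@no_solution_4 s k y z w) => //; rewrite -wE; ring.
  - by apply: (@no_solution_6 s k y z w) => //; rewrite -wE; ring.
  - by apply: (@no_square_8 s w) => //; rewrite -wE; ring.
left.
have [t sT] : exists t : nat, s = (t + 8)%N%:Z.
  by exists `|(s - 8)%R|%N; clear - s8; lia.
have [t' s'T] : exists t' : nat, s' = (t' + 8)%N%:Z.
  by exists `|(s' - 8)%R|%N; clear - s'8; lia.
have [h kH] : exists h : nat, k = (h + 16)%N%:Z.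
  by exists `|(k - 16)%R|%N; clear - k16; lia.
have [ny yN] : exists n : nat, y = n%:Z by exists `|y|%N; clear - y0; lia.
have [nz zN] : exists n : nat, z = n%:Z by exists `|z|%N; clear - z0; lia.
have list_case : exceptional (Z.of_nat (t + 8)) (Z.of_nat (t' + 8)) ->
    (s, s') \in [:: (9, 9); (12, 24); (16, 16); (24, 12);
                  (10, 40); (40, 10); (18, 32)].
  case/exceptionalP => [le8|]; first by clear - s'8 s'T le8; lia.
  by rewrite sT s'T !inE !xpair_eqE; clear; lia.
have tE : (t * h = 8 * (nz ^ 2 + 16))%N.
  by rewrite sT kH zN in sE; clear - sE; lia.
have [h200|h200] := ltnP h 200.
  apply: list_case.
  apply: (@small_k h t (t' + 8) ny nz `|x|%N).
  - by clear - h200 kH k16; lia.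
  - by clear - yN y0; lia.
  - by clear - zN z0; lia.
  - by rewrite yN zN kH in yz; clear - yz; lia.
  - exact: tE.
  - by rewrite s'T kH yN sT in s'E; clear - s'E; lia.
  - by rewrite (sqr_absz x) kH sT s'T in xE; clear - xE; lia.
have t0 : (0 < t)%N by clear - sT s8; lia.
have t'0 : (0 < t')%N by clear - s'T s'8; lia.
have bound : h%:Z * (t%:Z * t'%:Z - 64) < 128 * (t%:Z + t'%:Z + 16).
  apply: (@size_bound t t' h y z) => //.
  - by clear - h200; lia.
  - by rewrite kH in yz; clear - yz; lia.
  - by rewrite sT kH in sE; rewrite -sE; clear; lia.
  - by rewrite s'T kH sT in s'E; clear - s'E; lia.
have : [\/ exceptional (Z.of_nat (t + 8)) (Z.of_nat (t' + 8)),
      t = 1%N /\ t' = 64%N | t = 64%N /\ t' = 1%N].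
  apply: (@large_k t t' `|w|%N) => //.
    by clear - bound h200; nia.
  by rewrite (sqr_absz w) sT s'T in wE; clear - wE; lia.
case=> [//|[tt tt']|[tt tt']]; exfalso; rewrite tt in sT; rewrite tt' in s'T;
  rewrite sT s'T in sE s'E.
  by apply: (@no_solution_9_72 y z k) => //; rewrite -sE; ring.
by apply: (@no_solution_72_9 y z k).
Qed.

(** * Passage from real numbers to integers *)

Theorem theorem4 (R : realType) (y z k : int) (Sigma Sigma' x : R)
  (y_gt0 : 0 < y) (z_gt0 : 0 < z) (k_gt0 : 0 < k)
  (k_gt16 : 16 < k) (k_gtyz : y * z < k)
  (defSigma : Sigma = 8 * (z%:~R ^+ 2 + k%:~R) / (k%:~R - 16))
  (Sigma_int : Sigma \is a Num.int)
  (defSigma' : Sigma' = y%:~R ^+ 2 * Sigma / k%:~R)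
  (Sigma'_int : Sigma' \is a Num.int)
  (defx : x = Num.sqrt (k%:~R * (Sigma + Sigma') / 8))
  (x_int : x \is a Num.int) :
  [\/ (Sigma, Sigma') \in [:: (9, 9); (12, 24); (16, 16); (24, 12);
                              (10, 40); (40, 10); (18, 32)],
      exists m : int, (Sigma, Sigma') = (5 * m%:~R ^+ 2, 5) /\
        exists n Y Z : int, m ^+ 2 - 10 * n ^+ 2 = -1 /\
          (5 * m ^+ 2 - 8) * Y ^+ 2 = 5 + 8 * Z ^+ 2
    | exists m : int, (Sigma, Sigma') = (m%:~R ^+ 2, 1) /\
        exists n Y Z : int, m ^+ 2 - 2 * n ^+ 2 = -1 /\
          (m ^+ 2 - 8) * Y ^+ 2 = 1 + 8 * Z ^+ 2].
Proof.
have k0 : 0 < k%:~R :> R by rewrite ltr0z.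
have k16 : 0 < k%:~R - 16 :> R by rewrite subr_gt0 -[16]/(16%:~R) ltr_int.
have Sigma_ge0 : 0 <= Sigma.
  rewrite defSigma; apply: divr_ge0; last exact: ltW.
  by apply: mulr_ge0 => //; apply: addr_ge0; [exact: sqr_ge0 | exact: ltW].
have Sigma'_ge0 : 0 <= Sigma'.
  rewrite defSigma'; apply: divr_ge0; last exact: ltW.
  by apply: mulr_ge0 => //; exact: sqr_ge0.
(* [Num.sqrt] is 0 on negative numbers, so squaring it back needs a nonnegative radicand. *)
have xE : 8 * x ^+ 2 = k%:~R * (Sigma + Sigma').
  rewrite defx sqr_sqrtr; first by field.
  apply: divr_ge0 => //; apply: mulr_ge0; first exact: ltW.
  exact: addr_ge0.
have s'E : Sigma' * k%:~R = y%:~R ^+ 2 * Sigma.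
  by rewrite defSigma'; field; rewrite gt_eqF.
have sE : (Sigma - 8) * (k%:~R - 16) = 8 * (z%:~R ^+ 2 + 16).
  by rewrite defSigma; field; rewrite gt_eqF.
have /intrP[s sS] := Sigma_int; have /intrP[s' s'S] := Sigma'_int.
have /intrP[n nx] := x_int; rewrite {}sS {}s'S {}nx in sE s'E xE *.
(* The three relations descend to integers by injectivity of the embedding into [R]. *)
have {}sE : (s - 8) * (k - 16) = 8 * (z ^+ 2 + 16).
  by apply: (@intr_inj R); move: sE; rewrite !(rmorphM, rmorphB, rmorphD, rmorphXn).
have {}s'E : s' * k = y ^+ 2 * s.
  by apply: (@intr_inj R); move: s'E; rewrite !(rmorphM, rmorphB, rmorphD, rmorphXn).
have {}xE : 8 * n ^+ 2 = k * (s + s').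
  by apply: (@intr_inj R); move: xE; rewrite !(rmorphM, rmorphB, rmorphD, rmorphXn).
have [|[p [m [r [Y [Z [pP -> -> mr YZ]]]]]]] :=
  integer_classification _ _ _ _ _ _ y_gt0 z_gt0 k_gt16 k_gtyz sE s'E xE.
  rewrite !inE !xpair_eqE => ss'; apply: Or31.
  by move: ss'; rewrite -!(eqr_int R).
move: pP; rewrite !inE => /orP[] /eqP pE; rewrite pE in mr YZ *.
  apply: Or33; exists m; split; first by rewrite mul1r rmorphXn.
  by exists r, Y, Z; rewrite !mul1r ?mulr1 in mr YZ *.
apply: Or32; exists m; split; first by rewrite rmorphM rmorphXn.
by exists r, Y, Z.
Qed.
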